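(* For $5\le n\le 15$ the values of $\kappa_2(n)$ are: $\kappa_2(5)=3$, $\kappa_2(6)=4$, $\kappa_2(7)=5$, $\kappa_2(8)=4$, $\kappa_2(9)=5$, $\kappa_2(10)=5$, $\kappa_2(11)=5$, $\kappa_2(12)=5$, $\kappa_2(13)=5$, $\kappa_2(14)=5$, $\kappa_2(15)=5$.
   Context: For a real symmetric matrix $A=(a_{ij})$, $A^{\circ 2}=(a_{ij}^2)$ denotes its entrywise square and $n_+(A)$ denotes the number of positive eigenvalues of $A$, counted with multiplicity. For an integer $n\ge1$, $\kappa_2(n)$ is the minimum of $n_+(H)$ over all real symmetric circulant $n\times n$ matrices $H$ with (strictly) positive entries such that $H^{\circ 2}$ is positive definite. *)

(* Defs.v *)
From mathcomp Require Import all_boot all_order all_algebra.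
From mathcomp Require Import polyrcf.
From mathcomp Require Import boolp classical_sets reals.
Set Implicit Arguments.
Unset Strict Implicit.
Unset Printing Implicit Defensive.
Import Order.TTheory GRing.Theory Num.Theory.
Local Open Scope ring_scope.
Local Open Scope classical_set_scope.

(* Entry (i, j) depends only on j - i modulo n; the index is shifted by n
   because subtraction on nat is truncated. *)
Definition circulant (R : realType) (n : nat) (A : 'M[R]_n) : Prop :=
  exists c : nat -> R, forall i j : 'I_n, A i j = c ((j + n - i) %% n)%N.

Definition positive_entries (R : realType) (n : nat) (A : 'M[R]_n) : Prop :=
  forall i j : 'I_n, 0 < A i j.

Definition entrywise_square (R : realType) (n : nat) (A : 'M[R]_n) : 'M[R]_n :=
  map_mx (fun x : R => x ^+ 2) A.

Definition positive_definite (R : realType) (n : nat) (A : 'M[R]_n) : Prop :=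
  A^T = A /\
  forall x : 'cV[R]_n, x != 0 -> 0 < (x^T *m A *m x) ord0 ord0.

(* [rootsR] lists each real root once; [mup] is its multiplicity. *)
Definition n_plus (R : realType) (n : nat) (A : 'M[R]_n) : nat :=
  \sum_(x <- rootsR (char_poly A) | 0 < x) mup x (char_poly A).

Definition kappa2_set (R : realType) (n : nat) : set nat :=
  [set k | exists H : 'M[R]_n,
     [/\ H^T = H, circulant H, positive_entries H,
         positive_definite (entrywise_square H) & n_plus H = k]].

(* [xget 0] returns the minimum of the set, and would return 0 only if
   the set had no minimum, that is, were empty, or had minimum 0. *)
Definition kappa2 (R : realType) (n : nat) : nat :=
  xget 0%N (kappa2_set R n `&` lbound (kappa2_set R n)).

(* Main.v *)
(* The eigenvalues [l m] of a real symmetric circulant matrix with entries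
   [h (j - i)] are the discrete cosine sums of [h], so [n_+] counts the [m] with
   [l m > 0], and the entrywise square is positive definite iff the cyclic
   convolution [conv l] is positive everywhere. Positivity of the entries enters
   only through [0 < \sum_m l m], [|l m| <= l 0] and one product inequality.

   Lower bounds. If [l] has few positive values, they sit at [0], [+- s] and
   possibly [n/2]. If these indices lie in a proper subgroup, sum [l] over its
   cosets and look at the coset with the most negative sum: the convolution is
   not positive there. Otherwise another choice of the primitive root of unity
   makes [s = 1] (or [s = 2] when [n = 10]), and a few of the inequalities
   [0 < conv l m], with small [m], are contradictory.

   Upper bounds. Take a symmetric [S] with [S + S = Z/n], and [l] positive on
   [S], zero off [S], with dominant value [l 0]; then every [conv l m] is
   positive. For [n = 14, 15] no such [S] has five elements; [S + S] misses one
   index, or a pair, and small negative values of [l] make up for it. *)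

Require Import Defs.
From mathcomp Require Import all_boot all_order all_algebra.
From mathcomp Require Import cyclic separable cyclotomic polyrcf complex.
From mathcomp Require Import boolp classical_sets reals.
From mathcomp Require Import ring lra zify.
Set Implicit Arguments.
Unset Strict Implicit.
Unset Printing Implicit Defensive.
Import Order.TTheory GRing.Theory Num.Theory.
Local Open Scope ring_scope.

(** * Spectrum of a real symmetric circulant matrix *)

Lemma prim_root_exists (F : numClosedFieldType) n :
  (0 < n)%N -> exists z : F, n.-primitive_root z.
Proof.
move=> n_gt0; have [r Dp] := closed_field_poly_normal ('X^n - 1 : {poly F}).
rewrite (monicP _) ?monicXnsubC // scale1r in Dp.
have rn1: all n.-unity_root r by apply/allP=> z; rewrite -root_prod_XsubC -Dp.
have sz_r: (n < (size r).+1)%N.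
  by rewrite -(size_prod_XsubC r id) -Dp size_XnsubC.
have [|z _ prim_z] := hasP (has_prim_root n_gt0 rn1 _ sz_r); last by exists z.
by rewrite -separable_prod_XsubC -Dp separable_Xn_sub_1 // pnatr_eq0 -lt0n.
Qed.

(** Both characteristic polynomials become equal after multiplication by [\det P], which cancels; no
    inverse of [P] is formed. *)
Lemma char_poly_diagonalized (F : fieldType) n (A P : 'M[F]_n) (d : 'rV[F]_n) :
  \det P != 0 -> A *m P = P *m diag_mx d ->
  char_poly A = \prod_i ('X - (d 0 i)%:P).
Proof.
move=> detP AP.
have -> : \prod_i ('X - (d 0 i)%:P) = char_poly (diag_mx d).
  rewrite char_poly_trig; last first.
    by apply/is_trig_mxP => i j ij; rewrite mxE -val_eqE ltn_eqF.
  by apply: eq_bigr => i _; rewrite mxE eqxx.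
pose P' := map_mx polyC P.
have detP' : \det P' != 0 by rewrite det_map_mx polyC_eq0.
apply: (mulIf detP'); rewrite /char_poly -det_mulmx mulrC -det_mulmx.
congr (\det _); rewrite /char_poly_mx mulmxBl mulmxBr scalar_mxC.
by rewrite -!map_mxM AP.
Qed.

Lemma n_plus_count (R : realType) n (A : 'M[R]_n) (l : 'I_n -> R) :
  char_poly A = \prod_i ('X - (l i)%:P) -> n_plus A = #|[set i | 0 < l i]|.
Proof.
move=> cpA; rewrite /n_plus cpA.
have -> : \prod_i ('X - (l i)%:P) = \prod_(y <- map l (enum 'I_n)) ('X - y%:P).
  by rewrite big_map enumT.
set s := map _ _; set p := \prod_(_ <- _) _.
have p0 : p != 0 by rewrite monic_neq0 ?monic_prod_XsubC.
have rootsE : rootsR p =i undup s.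
  by move=> x; rewrite -(roots_on_rootsR p0 x) itv_boundlr mem_undup root_prod_XsubC.
have perm_roots : perm_eq (rootsR p) (undup s).
  by apply: uniq_perm rootsE; rewrite ?undup_uniq // uniq_roots.
rewrite (perm_big _ perm_roots) /=.
have count_s x : mup x p = (\sum_i (l i == x))%N.
  by rewrite mu_prod_XsubC count_map -sumn_count sumnE big_map big_enum.
under eq_bigr => x _ do rewrite count_s.
(* After the exchange, each index [i] with [0 < l i] contributes exactly once, at the root [l i]. *)
rewrite exchange_big /= -sum1dep_card [RHS]big_mkcond; apply: eq_bigr => i _.
have lis : l i \in undup s by rewrite mem_undup map_f ?mem_enum.
rewrite big_mkcond (bigD1_seq _ lis (undup_uniq s)) /= eqxx big1 ?addn0 //.
by move=> x /negPf; rewrite eq_sym => ->; rewrite if_same.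
Qed.

Definition conv (R : pzRingType) n' (f : 'I_n'.+1 -> R) (m : 'I_n'.+1) : R :=
  \sum_a f a * f (m - a).

Definition circ (R : Type) n' (h : 'I_n'.+1 -> R) : 'M[R]_n'.+1 :=
  \matrix_(i, j) h (j - i).

(** * Discrete cosine and sine sums on Z/n *)

Section Harmonics.

Variables (R : rcfType) (n' : nat) (w : R[i]).
Local Notation n := n'.+1.
Local Notation V := 'I_n.
Hypothesis prim_w : n.-primitive_root w.

(** The values [cos (2 pi u m k / n)] and [sin (2 pi u m k / n)] for [w = exp (2 pi i u / n)]. The
    primitive root stays arbitrary so that it can be changed later. *)
Definition cs (m k : V) : R := complex.Re (w ^+ (m * k)).
Definition sn (m k : V) : R := complex.Im (w ^+ (m * k)).

Lemma expw_modr (m k : nat) : w ^+ (m * (k %% n)) = w ^+ (m * k).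
Proof. by rewrite -(prim_expr_mod prim_w) modnMmr (prim_expr_mod prim_w). Qed.

Lemma expwD (m i j : V) : w ^+ (m * (i + j)%R) = w ^+ (m * i) * w ^+ (m * j).
Proof. by rewrite /= expw_modr mulnDr exprD. Qed.

Lemma csC m k : cs m k = cs k m. Proof. by rewrite /cs mulnC. Qed.
Lemma snC m k : sn m k = sn k m. Proof. by rewrite /sn mulnC. Qed.

Lemma csm0 m : cs m 0 = 1. Proof. by rewrite /cs muln0. Qed.
Lemma snm0 m : sn m 0 = 0. Proof. by rewrite /sn muln0. Qed.
Lemma cs0m m : cs 0 m = 1. Proof. by rewrite csC csm0. Qed.

Lemma csD m i j : cs m (i + j) = cs m i * cs m j - sn m i * sn m j.
Proof. by rewrite /cs /sn expwD; case: (w ^+ _) => a b; case: (w ^+ _) => c d. Qed.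

Lemma snD m i j : sn m (i + j) = cs m i * sn m j + sn m i * cs m j.
Proof. by rewrite /cs /sn expwD; case: (w ^+ _) => a b; case: (w ^+ _) => c d. Qed.

Lemma cs2_sn2 m k : cs m k ^+ 2 + sn m k ^+ 2 = 1.
Proof.
have : `|w ^+ (m * k)| = 1.
  suff /eqP w1 : `|w| == 1 by rewrite normrX w1 expr1n.
  by rewrite -(@pexpr_eq1 _ _ n) // -normrX (prim_expr_order prim_w) normr1.
rewrite /cs /sn; case: (w ^+ _) => a b /= /(congr1 (fun z => z ^+ 2)).
rewrite normc_def /= -rmorphXn /= sqr_sqrtr ?addr_ge0 ?sqr_ge0 // expr1n.
by move/(congr1 (@complex.Re R)).
Qed.

(** The addition formulas at [k] and [- k] form a linear system for [cs m (- k)] and [sn m (- k)],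
    with determinant [cs m k ^+ 2 + sn m k ^+ 2 = 1]. *)
Lemma csN m k : cs m (- k) = cs m k.
Proof.
have := csD m k (- k); have := snD m k (- k); rewrite subrr csm0 snm0.
have := cs2_sn2 m k; move: (cs m (- k)) (sn m (- k)) (cs m k) (sn m k) => c d a b ab E0 E1.
by rewrite -[c]mul1r -ab -[RHS]mulr1 E1 -[RHS]addr0 -(mulr0 b) E0; ring.
Qed.

Lemma snN m k : sn m (- k) = - sn m k.
Proof.
have := csD m k (- k); have := snD m k (- k); rewrite subrr csm0 snm0.
have := cs2_sn2 m k; move: (cs m (- k)) (sn m (- k)) (cs m k) (sn m k) => c d a b ab E0 E1.
by rewrite -[d]mul1r -ab -[RHS]mulr1 E1 -[RHS]addr0 -(mulr0 a) E0; ring.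
Qed.

Lemma cs_le1 m k : `|cs m k| <= 1.
Proof. by rewrite -(@expr_le1 _ 2) // real_normK ?num_real // -(cs2_sn2 m k) lerDl sqr_ge0. Qed.

Lemma sum_expw (k : V) : \sum_(m : V) w ^+ (m * k) = (n * (k == 0))%:R.
Proof.
have [->|k0] := eqVneq k 0.
  rewrite (eq_bigr (fun=> 1)) ?sumr_const ?card_ord ?muln1 //.
  by move=> m _; rewrite muln0.
have wk1 : w ^+ k - 1 != 0.
  by rewrite subr_eq0 -(prim_order_dvd prim_w) gtnNdvd ?lt0n.
rewrite muln0; apply: (mulfI wk1); rewrite mulr0.
under eq_bigr => m _ do rewrite mulnC exprM.
by rewrite -subrX1 exprAC (prim_expr_order prim_w) expr1n subrr.
Qed.

Lemma sum_cs k : \sum_m cs m k = (n * (k == 0))%:R.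
Proof.
rewrite -(raddf_sum (@complex.Re R)) sum_expw.
by rewrite -(rmorph_nat (real_complex R)).
Qed.

Lemma sum_sn k : \sum_m sn m k = 0.
Proof.
rewrite -(raddf_sum (@complex.Im R)) sum_expw.
by rewrite -(rmorph_nat (real_complex R)).
Qed.

Lemma sum_cs_cs i j :
  \sum_m cs m i * cs m j = n%:R / 2 * ((i == j)%:R + (i == - j)%:R).
Proof.
transitivity (\sum_m (cs m (i - j) + cs m (i + j)) / 2).
  by apply: eq_bigr => m _; rewrite !csD csN snN; field.
rewrite -mulr_suml big_split /= !sum_cs subr_eq0 addr_eq0 !natrM; ring.
Qed.

Lemma sum_cs_sn i j : \sum_m cs m i * sn m j = 0.
Proof.
transitivity (\sum_m (sn m (i + j) - sn m (i - j)) / 2).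
  by apply: eq_bigr => m _; rewrite !snD csN snN; field.
by rewrite -mulr_suml sumrB !sum_sn subr0 mul0r.
Qed.

(** The cosine half of the Fourier transform, which is all of it for even [h], where the sine half
    cancels. *)
Definition dft (h : V -> R) (m : V) : R := \sum_k h k * cs m k.

Lemma dftN h m : dft h (- m) = dft h m.
Proof. by apply: eq_bigr => k _; rewrite csC csN csC. Qed.

Section Even.

Variable h : V -> R.
Hypothesis hN : forall k, h (- k) = h k.

Lemma sum_even_sn m : \sum_k h k * sn m k = 0.
Proof.
have E : \sum_k h k * sn m k = - \sum_k h k * sn m k.
  rewrite -sumrN (reindex_inj oppr_inj); apply: eq_bigr => k _ /=.
  by rewrite hN snN mulrN.
by move: E; set S := \sum_(_ | _) _; lra.
Qed.

Lemma sum_even_cs_cs j :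
  \sum_k h k * (\sum_m cs m k * cs m j) = n%:R * h j.
Proof.
under eq_bigr => k _ do rewrite sum_cs_cs mulrCA mulrDr.
rewrite -mulr_sumr big_split /= (bigD1 j) //= eqxx big1; last first.
  by move=> k /negPf ->; rewrite mulr0.
rewrite (bigD1 (- j)) //= eqxx big1; last first.
  by move=> k /negPf ->; rewrite mulr0.
by rewrite hN /= !mulr1n; field.
Qed.

Lemma dft_dft k : dft (dft h) k = n%:R * h k.
Proof.
rewrite -sum_even_cs_cs /dft; under eq_bigr => m _ do rewrite mulr_suml.
rewrite exchange_big; apply: eq_bigr => j _; rewrite mulr_sumr.
by apply: eq_bigr => m _; rewrite (csC k) mulrA.
Qed.

(** Expand [cs j (m - a)] by the subtraction formula and sum over [a] first: orthogonality leaves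
    only [k = j] and [k = - j], which evenness of [h] merges, and the mixed cosine-sine sums
    vanish. *)
Lemma conv_dft m : conv (dft h) m = n%:R * dft (fun k => h k ^+ 2) m.
Proof.
transitivity (\sum_j h j * cs m j * (\sum_k h k * (\sum_a cs a k * cs a j))).
  rewrite /conv.
  transitivity (\sum_a \sum_j \sum_k h j * h k * (cs a k * cs j (m - a))).
    apply: eq_bigr => a _; rewrite /dft mulr_suml exchange_big /=.
    apply: eq_bigr => k _; rewrite mulr_sumr; apply: eq_bigr => j _.
    by rewrite (csC j); ring.
  rewrite exchange_big; apply: eq_bigr => j _.
  rewrite exchange_big mulr_sumr; apply: eq_bigr => k _ /=.
  rewrite -mulr_sumr; transitivity (h j * h k * (cs m j * (\sum_a cs a k * cs a j)
    + sn m j * (\sum_a cs a k * sn a j))).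
    congr (_ * _); rewrite !mulr_sumr -big_split; apply: eq_bigr => a _ /=.
    by rewrite csD csN snN (csC j m) (csC j a) (snC j m) (snC j a); ring.
  by rewrite sum_cs_sn; ring.
under eq_bigr => j _ do rewrite sum_even_cs_cs.
by rewrite /dft mulr_sumr; apply: eq_bigr => j _; ring.
Qed.

Lemma sum_dft : \sum_m dft h m = n%:R * h 0.
Proof.
by rewrite -dft_dft; apply: eq_bigr => m _; rewrite cs0m mulr1.
Qed.

Lemma circ_mul_cs m i : \sum_j h (j - i) * cs m j = dft h m * cs m i.
Proof.
rewrite (reindex_inj (addIr i)) /=.
under eq_bigr => k _ do rewrite addrK csD mulrBr !mulrA.
by rewrite sumrB -!mulr_suml sum_even_sn mul0r subr0.
Qed.

Lemma circ_mul_sn m i : \sum_j h (j - i) * sn m j = dft h m * sn m i.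
Proof.
rewrite (reindex_inj (addIr i)) /=.
under eq_bigr => k _ do rewrite addrK snD mulrDr !mulrA.
by rewrite big_split /= -!mulr_suml sum_even_sn mul0r addr0.
Qed.

Lemma char_poly_circ : char_poly (circ h) = \prod_m ('X - (dft h m)%:P).
Proof.
(* The Hartley matrix diagonalises [circ h] without leaving the reals. *)
pose F : 'M_n := \matrix_(i, j) (cs j i + sn j i).
have FF : F *m F = n%:R%:M.
  apply/matrixP => i j; rewrite !mxE.
  transitivity (\sum_k (cs k (i - j) + sn k (i + j))).
    apply: eq_bigr => k _; rewrite !mxE csD snD csN snN (csC j) (snC j); ring.
  by rewrite big_split /= sum_cs sum_sn addr0 subr_eq0 natrM mulr_natr.
have detF : \det F != 0.
  have /(congr1 determinant) := FF; rewrite det_mulmx det_scalar => FF'.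
  apply: contraTneq (isT) => F0; move/eqP: FF'.
  by rewrite F0 mul0r eq_sym expf_eq0 pnatr_eq0.
rewrite (char_poly_diagonalized (d := \row_m dft h m) detF).
  by apply: eq_bigr => m _; rewrite mxE.
apply/matrixP => i m; rewrite mul_mx_diag !mxE mulrC mulrDr -circ_mul_cs -circ_mul_sn.
by rewrite -big_split; apply: eq_bigr => j _; rewrite !mxE mulrDr.
Qed.

End Even.

Lemma dft_bound h m : (forall k, 0 < h k) -> `|dft h m| <= dft h 0.
Proof.
move=> h_gt0; apply: le_trans (ler_norm_sum _ _ _) _; apply: ler_sum => k _.
by rewrite cs0m mulr1 normrM gtr0_norm // ler_piMr ?cs_le1 // ltW.
Qed.

(** The right-hand side is the sum of [h k * (1 + cs a k) * (1 + cs b k)], whose factors are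
    nonnegative. It serves the case [n = 14]. *)
Lemma dft_pair_bound h a b : (forall k, 0 < h k) ->
  0 <= dft h 0 + dft h a + dft h b + (dft h (a + b) + dft h (a - b)) / 2.
Proof.
move=> h_gt0.
have -> : dft h 0 + dft h a + dft h b + (dft h (a + b) + dft h (a - b)) / 2 =
    \sum_k h k * ((1 + cs a k) * (1 + cs b k)).
  rewrite /dft -!big_split mulr_suml -!big_split; apply: eq_bigr => k _ /=.
  by rewrite cs0m !(csC _ k) !csD csN snN; field.
apply: sumr_ge0 => k _.
have cs_ge m : 0 <= 1 + cs m k.
  by have := cs_le1 m k; rewrite ler_norml => /andP[]; lra.
by rewrite !mulr_ge0 // ltW.
Qed.

End Harmonics.

(** * Positive definiteness of circulant matrices *)

Section RealHarmonics.

Variables (R : realType) (n' : nat) (w : R[i]).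
Local Notation n := n'.+1.
Local Notation V := 'I_n.
Hypothesis prim_w : n.-primitive_root w.
Variable h : V -> R.
Hypothesis hN : forall k, h (- k) = h k.

(** Test the form on the cosine eigenvector of index [m], which is nonzero since its entry at 0 is
    1. *)
Lemma positive_definite_dft m :
  positive_definite (circ h) -> 0 < dft w h m.
Proof.
case=> _ /(_ (\col_j cs w m j)).
have -> : (\col_j cs w m j)^T *m circ h *m (\col_j cs w m j) =
    (dft w h m * \sum_j cs w m j ^+ 2)%:M.
  rewrite -mulmxA; apply/matrixP => i j; rewrite !ord1 !mxE mulr1n mulr_sumr.
  apply: eq_bigr => k _; rewrite !mxE.
  under eq_bigr => a _ do rewrite !mxE.
  by rewrite circ_mul_cs //; ring.
rewrite mxE mulr1n => /(_ _) H; have {H} : 0 < dft w h m * \sum_j cs w m j ^+ 2.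
  apply: H; apply/eqP => /matrixP/(_ 0 0); rewrite !mxE csm0.
  by apply/eqP; rewrite oner_eq0.
rewrite pmulr_lgt0 // (bigD1 0) //= csm0 expr1n ltr_pwDl //.
by apply: sumr_ge0 => k _; rewrite sqr_ge0.
Qed.

Lemma dft_positive_definite :
  (forall m, 0 < dft w h m) -> positive_definite (circ h).
Proof.
move=> dft_gt0; split.
  by apply/matrixP => i j; rewrite !mxE -opprB hN.
(* [q m] is the squared modulus of the Fourier coefficient of [x] at [m]. Parseval gives [sum_q],
   and [xE] is the quadratic form in the Fourier basis. *)
move=> x x0; pose q m := (\sum_i cs w m i * x i 0) ^+ 2 + (\sum_i sn w m i * x i 0) ^+ 2.
have qE m : q m = \sum_i \sum_j cs w m (j - i) * (x i 0 * x j 0).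
  rewrite /q !expr2 !mulr_suml -big_split; apply: eq_bigr => i _ /=.
  rewrite !mulr_sumr -big_split; apply: eq_bigr => j _ /=.
  by rewrite csD ?csN ?snN //; ring.
have sum_q : \sum_m q m = n%:R * \sum_i x i 0 ^+ 2.
  under eq_bigr => m _ do rewrite qE.
  rewrite exchange_big mulr_sumr; apply: eq_bigr => i _.
  rewrite exchange_big (bigD1 i) //= -mulr_suml sum_cs // subrr eqxx muln1.
  rewrite big1 ?addr0 // => j ji; rewrite -mulr_suml sum_cs //.
  by rewrite subr_eq0 (negPf ji) muln0 mul0r.
have xE : n%:R * (x^T *m circ h *m x) 0 0 = \sum_m dft w h m * q m.
  under eq_bigr => m _ do rewrite qE mulr_sumr.
  rewrite -mulmxA mxE exchange_big mulr_sumr; apply: eq_bigr => i _.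
  under eq_bigr => m _ do rewrite mulr_sumr.
  rewrite exchange_big !mxE !mulr_sumr; apply: eq_bigr => j _ /=.
  under eq_bigr => m _ do rewrite mulrA (csC w m).
  by rewrite -mulr_suml -/(dft w (dft w h) (j - i)) dft_dft // !mxE; ring.
have q_ge0 m : 0 <= q m by rewrite addr_ge0 ?sqr_ge0.
have n_gt0 : 0 < n%:R :> R by rewrite ltr0n.
rewrite -(pmulr_rgt0 _ n_gt0) xE lt0r sumr_ge0 ?andbT; last first.
  by move=> m _; rewrite mulr_ge0 // ltW.
apply: contraNneq x0 => /eqP; rewrite psumr_eq0 => [/allP dq0|m _]; last first.
  by rewrite mulr_ge0 // ltW.
have : \sum_i x i 0 ^+ 2 = 0.
  apply: (mulfI (lt0r_neq0 n_gt0)); rewrite -sum_q mulr0 big1 // => m _.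
  have := dq0 m; rewrite mem_index_enum mulf_eq0 gt_eqF //= => /(_ isT)/eqP.
  by [].
move/eqP; rewrite psumr_eq0 => [/allP x0|i _]; last by rewrite sqr_ge0.
apply/eqP/matrixP => i j; rewrite ord1 mxE; apply/eqP.
by have := x0 i; rewrite mem_index_enum sqrf_eq0 => /(_ isT).
Qed.

End RealHarmonics.

(** * Functions with few positive values *)

Section Subgroup.

Variables (R : realFieldType) (n' : nat).
Local Notation V := 'I_n'.+1.
Variable K : {pred V}.
Hypothesis K0 : 0 \in K.
Hypothesis KB : forall i j, i \in K -> j \in K -> i - j \in K.

Let KN i : i \in K -> - i \in K.
Proof. by move=> Ki; rewrite -sub0r KB. Qed.

Let KD i j : i \in K -> j \in K -> i + j \in K.
Proof. by move=> Ki Kj; rewrite -[j]opprK KB ?KN. Qed.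

Let sum_gt0K (g : V -> R) : (forall j, 0 < g j) -> 0 < \sum_(j | j \in K) g j.
Proof.
move=> g_gt0; rewrite (bigD1 0) //= ltr_pwDl // sumr_ge0 // => j _.
exact: ltW.
Qed.

(* With [x] minimising [f] off [K], each term of the convolution satisfies
   [f a * f (x - a) <= f x * f a]; hence [conv f x <= f x * \sum_a f a <= 0]. *)
Lemma periodic_conv_absurd (f : V -> R) :
  (forall i j, j \in K -> f (i + j) = f i) ->
  (forall m, 0 < conv f m) -> 0 < \sum_m f m ->
  (exists x, x \notin K) -> (forall x, x \notin K -> f x <= 0) -> False.
Proof.
move=> fK conv_gt0 sum_gt0 [x0 Kx0] f_le0.
have [x Kx x_min] := @arg_minP _ _ _ x0 (fun x => x \notin K) f Kx0.
have f0_ge0 : 0 <= f 0.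
  rewrite leNgt; apply: contraL sum_gt0 => f0_lt0; rewrite -leNgt.
  apply: sumr_le0 => j _; have [Kj|] := boolP (j \in K); last exact: f_le0.
  by rewrite -[j]add0r fK // ltW.
have fx_le0 := f_le0 _ Kx.
suff : conv f x <= f x * \sum_m f m.
  by have := conv_gt0 x; have := mulr_le0_ge0 fx_le0 (ltW sum_gt0); lra.
rewrite mulr_sumr; apply: ler_sum => a _.
have [Ka|Ka] := boolP (a \in K).
  by rewrite fK ?KN // mulrC.
have [Kxa|Kxa] := boolP (x - a \in K).
  have -> : f (x - a) = f 0 by rewrite -[x - a]add0r fK.
  have -> : f a = f x by rewrite -[a](subKr x) fK ?KN.
  by rewrite ler_wnM2l // (le_trans fx_le0).
by rewrite mulrC ler_wnM2r ?f_le0 ?x_min.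
Qed.

Definition coset_sum (l : V -> R) (x : V) : R := \sum_(j | j \in K) l (x + j).

(** Coset sums are [K]-periodic, their convolution at [m] is the sum of [conv l (m + j + k)] over
    [j], [k] in [K], and their total is a positive multiple of that of [l]; so
    [periodic_conv_absurd] applies. *)
Lemma coset_sum_absurd (l : V -> R) :
  (forall m, 0 < conv l m) -> 0 < \sum_m l m ->
  (exists x, x \notin K) -> (forall x, x \notin K -> coset_sum l x <= 0) -> False.
Proof.
move=> conv_gt0 sum_gt0; apply: periodic_conv_absurd.
- move=> i j Kj; rewrite /coset_sum [RHS](reindex_inj (addrI j)) /=.
  apply: eq_big => [k|k _]; last by rewrite addrA.
  apply/idP/idP => [|Kjk]; first exact: KD.
  by rewrite -[k](addKr j) addrC KB.
- move=> m; have -> : conv (coset_sum l) m =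
      \sum_(j | j \in K) \sum_(k | k \in K) conv l (m + j + k).
    rewrite /conv /coset_sum; under eq_bigr => a _ do rewrite mulr_suml.
    rewrite exchange_big; apply: eq_bigr => j _.
    under eq_bigr => a _ do rewrite mulr_sumr.
    rewrite exchange_big; apply: eq_bigr => k _.
    rewrite [RHS](reindex_inj (addIr j)); apply: eq_bigr => a _ /=.
    by congr (_ * l _); rewrite [m + j + k]addrAC opprD [- a - j]addrC addrA addrK addrAC.
  by apply: sum_gt0K => j; apply: sum_gt0K => k.
rewrite exchange_big; apply: sum_gt0K => j.
suff -> : \sum_i l (i + j) = \sum_i l i by [].
by rewrite [RHS](reindex_inj (addIr j)).
Qed.
End Subgroup.

(* An even function on Z/n is read off at the indices [0 <= k <= n/2]; on these,
   concrete convolutions expand to explicit polynomials. *)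
Definition fold_index (n k : nat) : nat := minn k (n - k).

Definition conv_index (n m : nat) : seq (nat * nat) :=
  [seq (fold_index n a, fold_index n ((m + (n - a)) %% n)) | a <- iota 0 n].

Definition nat_conv (R : pzRingType) (n : nat) (F : nat -> R) (m : nat) : R :=
  \sum_(ij <- conv_index n m) F ij.1 * F ij.2.

Definition nat_sum (R : pzRingType) (n : nat) (F : nat -> R) : R :=
  \sum_(k <- [seq fold_index n a | a <- iota 0 n]) F k.

Definition nat_admissible (R : realDomainType) (n : nat) (F : nat -> R) : Prop :=
  [/\ forall m, 0 < nat_conv n F m, 0 < nat_sum n F & forall k, `|F k| <= F 0].

Ltac expand_conv :=
  rewrite /nat_conv /nat_sum;
  repeat match goal with |- context [conv_index ?n ?m] =>
    let s := eval vm_compute in (conv_index n m) in change (conv_index n m) with s end;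
  repeat match goal with |- context [map ?f (iota 0 ?n)] =>
    let s := eval vm_compute in (map f (iota 0 n)) in change (map f (iota 0 n)) with s end;
  rewrite ?big_cons ?big_nil /=.

(** Linear arithmetic treats products as atoms, so the signs of all [F i * F j] with
    [2 <= i <= j <= 7] are supplied by hand. *)
Ltac move_products NN :=
  move: (NN 2%N 2%N isT isT) (NN 2%N 3%N isT isT) (NN 2%N 4%N isT isT)
    (NN 2%N 5%N isT isT) (NN 2%N 6%N isT isT) (NN 2%N 7%N isT isT)
    (NN 3%N 3%N isT isT) (NN 3%N 4%N isT isT) (NN 3%N 5%N isT isT)
    (NN 3%N 6%N isT isT) (NN 3%N 7%N isT isT) (NN 4%N 4%N isT isT)
    (NN 4%N 5%N isT isT) (NN 4%N 6%N isT isT) (NN 4%N 7%N isT isT)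
    (NN 5%N 5%N isT isT) (NN 5%N 6%N isT isT) (NN 5%N 7%N isT isT)
    (NN 6%N 6%N isT isT) (NN 6%N 7%N isT isT) (NN 7%N 7%N isT isT).

(* In the application [p = l 0], [q = l 1], [x = - l 2], [y = - l 3] and
   [r = - (l 4 + l 5 + ...)], summed up to [(n - 1) / 2]. *)
Lemma generator_inequalities_odd (R : realFieldType) (p q x y r : R) : 0 < p -> 0 < q ->
  0 <= x -> 0 <= y -> 0 <= r ->
  p * y + r * (p + 2 * q) < p * x ->
  q * x <= x * r + r ^+ 2 ->
  2 * p * x + 2 * q * y < q ^+ 2 + 2 * r * (x + y + r) ->
  2 * (x + y + r) <= p + 2 * q -> False.
Proof.
move=> p_gt0 q_gt0 x_ge0 y_ge0 r_ge0 H1 H2 H3 H4.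
have py_ge0 : 0 <= p * y by rewrite mulr_ge0 // ltW.
have qy_ge0 : 0 <= q * y by rewrite mulr_ge0 // ltW.
have rp_ge0 : 0 <= r * p by rewrite mulr_ge0 // ltW.
have rq_ge0 : 0 <= r * q by rewrite mulr_ge0 // ltW.
have H4r : r * (2 * (x + y + r)) <= r * (p + 2 * q) by rewrite ler_wpM2l.
(* The contradiction is [q ^+ 2 <= 2 q r < p x < q ^+ 2], where [r <= x] turns the second inequality
   into [q <= 2 r]. *)
have px_lt : p * x < q ^+ 2 by lra.
have px_gt0 : 0 < p * x by lra.
have x_gt0 : 0 < x by rewrite -(pmulr_rgt0 _ p_gt0).
have r_le_x : r <= x by rewrite -(ler_pM2l p_gt0); lra.
have rr_le : r * r <= r * x by rewrite ler_wpM2l.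
have q_le : q <= 2 * r by rewrite -(ler_pM2r x_gt0); lra.
have : q * q <= q * (2 * r) by rewrite ler_pM2l.
lra.
Qed.

(** The first inequality gives [2 q < a]. Since [a b <= p b], it also bounds the term [2 a b] of the
    second, and [a <= p] then forces [a ^+ 2 < q ^+ 2]. *)
Lemma generator_inequalities7 (R : realFieldType) (p q a b : R) : a <= p -> 0 < q ->
  0 <= a -> 0 <= b ->
  2 * p * b + 2 * q * a + 2 * q * b < a ^+ 2 ->
  2 * p * a + 2 * q * b < q ^+ 2 + 2 * a * b -> False.
Proof.
move=> a_le_p q_gt0 a_ge0 b_ge0 H3 H2.
have qb_ge0 : 0 <= q * b by rewrite mulr_ge0 // ltW.
have pa_ge : a * a <= p * a by rewrite ler_wpM2r.
have pb_ge : a * b <= p * b by rewrite ler_wpM2r.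
have pb_ge0 : 0 <= a * b by rewrite mulr_ge0.
have a_gt0 : 0 < a.
  rewrite lt0r a_ge0 andbT; apply: contraTneq H3 => ->; rewrite -leNgt.
  by have := mulr_ge0 (le_trans a_ge0 a_le_p) b_ge0; lra.
have q_lt : 2 * q < a by rewrite -(ltr_pM2r a_gt0); lra.
have : q * (2 * q) < q * a by rewrite ltr_pM2l.
have : a * (2 * q) < a * a by rewrite ltr_pM2l.
have : 0 <= q * a by rewrite mulr_ge0 // ltW.
lra.
Qed.

(** The bounds on [d] are sharpened in turn: [q < d < 2 a, 2 b] and the last hypothesis give
    [2 a, 2 b < p], whence [d < a, b]. Then the first product inequality gives [p < a + c], against
    the last hypothesis. *)
Lemma generator_inequalities10 (R : realFieldType) (p q a b c d : R) :
  0 < p -> 0 < q -> 0 <= a -> 0 <= b -> 0 <= c -> 0 <= d ->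
  a <= p -> b <= p -> c <= p ->
  p * b + q * a + q * c < a * d + b * c ->
  p * d + 2 * q * c < 2 * a * b ->
  2 * a + 2 * b + 2 * c + d < p + 2 * q -> False.
Proof.
move=> p_gt0 q_gt0 a_ge0 b_ge0 c_ge0 d_ge0 a_le b_le c_le H3 H5 T.
have qa_ge0 : 0 <= q * a by rewrite mulr_ge0 // ltW.
have qc_ge0 : 0 <= q * c by rewrite mulr_ge0 // ltW.
have bc_le : b * c <= b * p by rewrite ler_wpM2l.
have ab_le : a * b <= a * p by rewrite ler_wpM2l.
have ab_le' : a * b <= p * b by rewrite ler_wpM2r.
have a_gt0 : 0 < a.
  by rewrite lt0r a_ge0 andbT; apply: contraTneq H3 => ->; rewrite -leNgt; lra.
have q_lt_d : q < d by rewrite -(ltr_pM2r a_gt0); lra.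
have d_lt_2a : d < 2 * a by rewrite -(ltr_pM2l p_gt0); lra.
have d_lt_2b : d < 2 * b by rewrite -(ltr_pM2l p_gt0); lra.
have p_gt_2a : 2 * a < p by lra.
have p_gt_2b : 2 * b < p by lra.
have b_gt0 : 0 < b by lra.
have d_lt_a : d < a.
  have ab_lt : a * (2 * b) < a * p by rewrite ltr_pM2l.
  by rewrite -(ltr_pM2l p_gt0); lra.
have d_lt_b : d < b.
  have ba_lt : b * (2 * a) < b * p by rewrite ltr_pM2l.
  by rewrite -(ltr_pM2l p_gt0); lra.
have ad_lt : a * d < a * b by rewrite ltr_pM2l.
suff : p < a + c by lra.
by rewrite -(ltr_pM2l b_gt0); lra.
Qed.

(** The first product inequality gives [q < c] and [r < b], hence [2 a + b < p]; the third then
    gives [2 c < b], and the second becomes [p b < 2 a b + b ^+ 2 < p b]. *)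
Lemma even_generator_inequalities10 (R : realFieldType) (p q r a b c : R) :
  0 < p -> 0 < q -> 0 < r -> 0 <= a -> 0 <= b -> 0 <= c ->
  (p + q) * a + r * c + q * b < b * c ->
  p * b + q * a < a * c + r * q + b * c ->
  2 * p * c + 2 * r * a + 2 * q * c < 2 * a * b + q ^+ 2 + b ^+ 2 ->
  2 * a + 2 * b + 2 * c < p + r + 2 * q -> False.
Proof.
move=> p_gt0 q_gt0 r_gt0 a_ge0 b_ge0 c_ge0 H1 H3 H4 T.
have pa_ge0 : 0 <= (p + q) * a by rewrite mulr_ge0 // addr_ge0 // ltW.
have ra_ge0 : 0 <= r * a by rewrite mulr_ge0 // ltW.
have rc_ge0 : 0 <= r * c by rewrite mulr_ge0 // ltW.
have qa_ge0 : 0 <= q * a by rewrite mulr_ge0 // ltW.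
have qb_ge0 : 0 <= q * b by rewrite mulr_ge0 // ltW.
have b_gt0 : 0 < b.
  by rewrite lt0r b_ge0 andbT; apply: contraTneq H1 => ->; rewrite -leNgt; lra.
have c_gt0 : 0 < c.
  by rewrite lt0r c_ge0 andbT; apply: contraTneq H1 => ->; rewrite -leNgt; lra.
have q_lt_c : q < c by rewrite -(ltr_pM2r b_gt0); lra.
have r_lt_b : r < b by rewrite -(ltr_pM2r c_gt0); lra.
have ab_lt_p : 2 * a + b < p by lra.
have : b * (2 * a + b) < b * p by rewrite ltr_pM2l.
have : q * q < q * c by rewrite ltr_pM2l.
have : r * q < b * c by apply: ltr_pM => //; rewrite ltW.
have : 0 <= q * c by rewrite mulr_ge0 // ltW.
move=> qc_ge0 rq_lt qq_lt bp_gt.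
have c_lt : 2 * c < b by rewrite -(ltr_pM2l p_gt0); lra.
have : b * (2 * c) < b * b by rewrite ltr_pM2l.
have : a * c <= a * (2 * b) by rewrite ler_wpM2l //; lra.
lra.
Qed.

(** * Contradictions from explicit convolutions *)

Section Explicit.

Variables (R : realFieldType) (n : nat) (F : nat -> R).
Hypothesis F_adm : nat_admissible n F.

Let F0_gt0 : 0 < F 1%N -> 0 < F 0%N.
Proof. by case: F_adm => _ _ /(_ 1%N) + F1; rewrite gtr0_norm //; apply: lt_le_trans. Qed.

Let conv_gt0 m : 0 < nat_conv n F m. Proof. by case: F_adm. Qed.
Let sum_gt0 : 0 < nat_sum n F. Proof. by case: F_adm. Qed.

Let F0D_ge0 i : 0 <= F 0%N + F i.
Proof. by case: F_adm => _ _ /(_ i); rewrite ler_norml => /andP[]; lra. Qed.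

Let F0B_ge0 i : 0 <= F 0%N - F i.
Proof. by case: F_adm => _ _ /(_ i); rewrite ler_norml => /andP[]; lra. Qed.

Lemma generator_absurd6 : n = 6%N ->
  (forall k, (1 < k)%N -> F k <= 0) -> 0 < F 1%N -> False.
Proof.
move=> n6 N F1; have := conv_gt0 3; rewrite n6; expand_conv.
have := mulr_ge0_le0 (ltW F1) (N 2%N isT).
have := mulr_ge0_le0 (ltW (F0_gt0 F1)) (N 3%N isT).
lra.
Qed.

(** In [conv 3] the nonnegative product [F 2 * F 3] is absorbed by [F 0 * F 3], since [F 0 + F 2] is
    nonnegative. *)
Lemma generator_absurd8 : n = 8%N ->
  (forall k, (1 < k)%N -> F k <= 0) -> 0 < F 1%N -> False.
Proof.
move=> n8 N F1; have := conv_gt0 3; rewrite n8; expand_conv.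
have := mulr_ge0_le0 (ltW F1) (N 2%N isT).
have := mulr_ge0_le0 (ltW F1) (N 4%N isT).
have := mulr_ge0_le0 (F0D_ge0 2) (N 3%N isT).
lra.
Qed.

Lemma generator_absurd7 : n = 7%N ->
  (forall k, (1 < k)%N -> F k <= 0) -> 0 < F 1%N -> False.
Proof.
move=> n7 N F1; move: (N 2%N isT) (N 3%N isT) (F0D_ge0 2) => N2 N3 B2.
apply: (@generator_inequalities7 _ (F 0%N) (F 1%N) (- F 2%N) (- F 3%N)); try lra.
  by have := conv_gt0 3; rewrite n7; expand_conv; lra.
by have := conv_gt0 2; rewrite n7; expand_conv; lra.
Qed.

(* The indices are folded modulo 7: [p = F 0 + F 7], [q = F 1 + F 6], and so on. *)
Lemma generator_absurd14 : n = 14%N ->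
  (forall k, (1 < k < 6)%N -> F k <= 0) ->
  0 <= F 0%N + F 7%N + F 2%N + F 5%N -> F 1%N + F 6%N <= 0.
Proof.
move=> n14 N B; rewrite leNgt; apply/negP => F16.
move: (N 2%N isT) (N 3%N isT) (N 4%N isT) (N 5%N isT) => N2 N3 N4 N5.
apply: (@generator_inequalities7 _ (F 0%N + F 7%N) (F 1%N + F 6%N) (- (F 2%N + F 5%N))
  (- (F 3%N + F 4%N))); try lra.
  (* As 10 is the opposite of 4 modulo 14, the sum of the convolutions at 3 and 4 is that of the
     folded function at 3; likewise for 2 and 5 on the next line. *)
  by move: (conv_gt0 3) (conv_gt0 4); rewrite n14; expand_conv; lra.
by move: (conv_gt0 2) (conv_gt0 5); rewrite n14; expand_conv; lra.
Qed.

(** Half of [conv 3] is [(F 0 + F 6) * F 3 + (F 1 + F 5) * (F 2 + F 4)], a convolution folded modulo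
    6. The sign of [F 6] stays free. *)
Lemma generator_absurd12 : n = 12%N ->
  (forall k, (1 < k < 5)%N -> F k <= 0) -> F 1%N + F 5%N <= 0.
Proof.
move=> n12 N; rewrite leNgt; apply/negP => F15.
move: (N 2%N isT) (N 3%N isT) (N 4%N isT) => N2 N3 N4.
have N24 : F 2%N + F 4%N <= 0 by lra.
have := mulr_ge0_le0 (ltW F15) N24; have := mulr_ge0_le0 (F0D_ge0 6) N3.
by have := conv_gt0 3; rewrite n12; expand_conv; lra.
Qed.

Lemma generator_absurd10 : n = 10%N ->
  (forall k, (1 < k)%N -> k != 5%N -> F k <= 0) -> 0 < F 1%N -> False.
Proof.
move=> n10 N F1; have F0 := F0_gt0 F1.
have [N2 N3 N4] : [/\ F 2%N <= 0, F 3%N <= 0 & F 4%N <= 0] by rewrite !N.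
move: (F0D_ge0 2) (F0D_ge0 3) (F0D_ge0 4) => B2 B3 B4.
(* If [F 5] is positive, [conv 3] alone is contradictory. *)
have [F5|F5] := leP (F 5%N) 0.
  apply: (@generator_inequalities10 _ (F 0%N) (F 1%N) (- F 2%N) (- F 3%N) (- F 4%N) (- F 5%N));
    try lra.
  - by have := conv_gt0 3; rewrite n10; expand_conv; lra.
  - by have := conv_gt0 5; rewrite n10; expand_conv; lra.
  - by have := sum_gt0; rewrite n10; expand_conv; lra.
have := mulr_ge0_le0 (ltW F1) N2; have := mulr_ge0_le0 (ltW F1) N4.
have := mulr_ge0_le0 (ltW F5) N2; have := mulr_ge0_le0 B4 N3.
by have := conv_gt0 3; rewrite n10; expand_conv; lra.
Qed.

Lemma even_generator_absurd10 : n = 10%N ->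
  F 1%N <= 0 -> F 3%N <= 0 -> F 4%N <= 0 -> 0 < F 2%N -> 0 < F 5%N -> False.
Proof.
move=> n10 N1 N3 N4 F2 F5.
have F0 : 0 < F 0%N by have := F0B_ge0 2; lra.
apply: (@even_generator_inequalities10 _ (F 0%N) (F 2%N) (F 5%N) (- F 1%N) (- F 3%N) (- F 4%N));
  try lra.
- by have := conv_gt0 1; rewrite n10; expand_conv; lra.
- by have := conv_gt0 3; rewrite n10; expand_conv; lra.
- by have := conv_gt0 4; rewrite n10; expand_conv; lra.
- by have := sum_gt0; rewrite n10; expand_conv; lra.
Qed.

Lemma generator_absurd_odd : n \in [:: 9; 11; 13; 15] ->
  (forall k, (1 < k)%N -> F k <= 0) -> (forall k, (n./2 < k)%N -> F k = 0) ->
  0 < F 1%N -> False.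
Proof.
move=> n_odd N Z F1; have F0 := F0_gt0 F1.
have NN i j : (1 < i)%N -> (1 < j)%N -> 0 <= F i * F j.
  by move=> /N Fi /N Fj; rewrite mulr_le0.
move: (N 2%N isT) (N 3%N isT) (N 4%N isT) (N 5%N isT) (N 6%N isT) (N 7%N isT).
move=> N2 N3 N4 N5 N6 N7.
(* Entries beyond [n / 2] vanish by [Z], so the same [r] serves all four values of [n]. *)
pose r := - (F 4%N + F 5%N + F 6%N + F 7%N).
have sumE : nat_sum n F = F 0%N + 2 * F 1%N + 2 * F 2%N + 2 * F 3%N - 2 * r.
  move: Z; rewrite /r; move: n_odd; rewrite !inE => /or4P[]/eqP-> Z;
  expand_conv;
  rewrite ?(Z 5%N isT) ?(Z 6%N isT) ?(Z 7%N isT); ring.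
have pN i j : (1 < i)%N -> 0 <= - F i * (F 0%N + F j).
  by move=> /N Fi; rewrite mulr_ge0 ?oppr_ge0.
have qN k : (1 < k)%N -> 0 <= - F k * F 1%N.
  by move=> /N Fk; rewrite mulr_ge0 ?oppr_ge0 // ltW.
have NT : 0 <= (- F 2%N - F 3%N + r) * nat_sum n F.
  by apply: mulr_ge0; [rewrite /r; lra | exact: ltW].
apply: (@generator_inequalities_odd _ (F 0%N) (F 1%N) (- F 2%N) (- F 3%N) r) => //;
  rewrite ?oppr_ge0 //; rewrite /r in sumE NT *.
- lra.
- (* [nat_sum ^ 2] is the sum of all [conv m], so it exceeds
     [conv 0 + 2 * conv 1 + 2 * conv 2]. *)
  move: NT; move_products NN.
  rewrite sumE; move: (conv_gt0 3) (conv_gt0 4) (conv_gt0 5) (conv_gt0 6) (conv_gt0 7).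
  move: Z; move: n_odd; rewrite !inE => /or4P[]/eqP-> Z; expand_conv;
  rewrite ?(Z 5%N isT) ?(Z 6%N isT) ?(Z 7%N isT); lra.
(* In [conv 3] the term pairing indices [n - 3] and 6 is [F 3] times [F 3], [F 5] or [F 6] according
   to [n]; [pN] absorbs it into [F 0 * F 3]. *)
- move: (qN 4%N isT) (pN 3%N 3%N isT) (pN 3%N 5%N isT) (pN 3%N 6%N isT); move_products NN.
  move: (conv_gt0 3) Z n_odd; rewrite !inE => + Z /or4P[]/eqP n_E;
  rewrite n_E in Z *; expand_conv; lra.
- move_products NN.
  move: (conv_gt0 2) Z n_odd; rewrite !inE => + Z /or4P[]/eqP n_E;
  rewrite n_E in Z *; expand_conv; lra.
- by have := sum_gt0; rewrite sumE; lra.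
Qed.

End Explicit.

Lemma circulant_circ (R : realType) n' (A : 'M[R]_n'.+1) :
  A^T = A -> circulant A ->
  exists2 h, (forall k, h (- k) = h k) & A = circ h.
Proof.
move=> symA [c Ac].
have cE (i j : 'I_n'.+1) : c ((j + n'.+1 - i) %% n'.+1)%N = A 0 (j - i).
  rewrite Ac /= subn0 modnDr modn_mod modnDmr addnBA //.
  exact: ltnW.
exists (A 0); last by apply/matrixP => i j; rewrite mxE Ac cE.
by move=> k; rewrite -sub0r -cE -Ac -[A in LHS]symA mxE.
Qed.

Lemma entrywise_square_circ (R : realType) n' (h : 'I_n'.+1 -> R) :
  entrywise_square (circ h) = circ (fun k => h k ^+ 2).
Proof. by apply/matrixP => i j; rewrite !mxE. Qed.

(** * Constraints on the spectrum *)

Section Admissible.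

Variables (R : realType) (n' : nat).
Local Notation n := n'.+1.
Local Notation V := 'I_n.
Implicit Types l : V -> R.

Definition admissible l : Prop :=
  [/\ forall m, l (- m) = l m, forall m, 0 < conv l m, 0 < \sum_m l m,
      forall m, `|l m| <= l 0 &
      forall a b, 0 <= l 0 + l a + l b + (l (a + b) + l (a - b)) / 2].

Lemma dft_admissible (w : R[i]) (h : V -> R) :
  n.-primitive_root w -> (forall k, h (- k) = h k) -> (forall k, 0 < h k) ->
  positive_definite (circ (fun k => h k ^+ 2)) -> admissible (dft w h).
Proof.
move=> prim_w hN h_gt0 pd; have n_gt0 : 0 < n%:R :> R by rewrite ltr0n.
split=> [m|m||m|a b].
- exact: dftN.
- rewrite conv_dft // mulr_gt0 // positive_definite_dft // => k.
  by rewrite hN.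
- by rewrite sum_dft // mulr_gt0.
- exact: dft_bound.
- exact: dft_pair_bound.
Qed.

Lemma dft_expr (w : R[i]) h (u : nat) (m : V) : n.-primitive_root w ->
  dft (w ^+ u) h m = dft w h (m *+ u).
Proof.
move=> prim_w; apply: eq_bigr => k _; rewrite /cs Zp_mulrn -exprM /=.
by rewrite [in RHS]mulnC (expw_modr prim_w) mulnA [(u * m)%N]mulnC mulnC.
Qed.

Lemma mulrn_coprime_inj (u : nat) : coprime u n -> injective (fun m : V => m *+ u).
Proof.
move=> co_un; suff inj0 (x : V) : x *+ u = 0 -> x = 0.
  by move=> a b /eqP; rewrite -subr_eq0 -mulrnBl => /eqP/inj0/subr0_eq.
rewrite Zp_mulrn => /(congr1 val) /= /eqP; rewrite -/(dvdn n _) Gauss_dvdl 1?coprime_sym //.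
by move=> n_x; apply/val_inj/eqP; apply: contraTT n_x; rewrite -lt0n => x_gt0; rewrite gtnNdvd.
Qed.

(** The cut at [n / 2] keeps the mirror images out, so that hypotheses such as [F k <= 0] for all
    [k > 1] can hold although [l (- 1)] is positive. *)
Definition nat_spectrum l (k : nat) : R := if (k <= n./2)%N then l (inZp k) else 0.

Lemma nat_spectrumE l (k : nat) : (forall m, l (- m) = l m) -> (k <= n)%N ->
  nat_spectrum l (fold_index n k) = l (inZp k).
Proof.
move=> lN k_le; rewrite /nat_spectrum /fold_index.
have -> : (minn k (n - k) <= n./2)%N by lia.
have [//|k_gt] := leqP k (n - k).
rewrite -[RHS]lN; congr l; apply/val_inj => /=.
have [->|k_lt] : k = n \/ (k < n)%N by lia.
  by rewrite subnn modnn subn0 modnn mod0n.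
by rewrite (modn_small k_lt).
Qed.

Lemma nat_spectrum_conv l m : (forall m, l (- m) = l m) ->
  nat_conv n (nat_spectrum l) m = conv l (inZp m).
Proof.
move=> lN; rewrite /nat_conv /conv_index big_map -[iota 0 n]/(index_iota 0 n).
rewrite big_mkord; apply: eq_bigr => a _ /=.
rewrite !nat_spectrumE // ?(ltnW (ltn_pmod _ _)) ?(ltnW (ltn_ord a)) //.
congr (l _ * l _); apply/val_inj; first by rewrite /= modn_small.
by rewrite /= modn_mod modnDm.
Qed.

Lemma nat_spectrum_sum l : (forall m, l (- m) = l m) ->
  nat_sum n (nat_spectrum l) = \sum_m l m.
Proof.
move=> lN; rewrite /nat_sum big_map -[iota 0 n]/(index_iota 0 n) big_mkord.
apply: eq_bigr => a _; rewrite nat_spectrumE // ?(ltnW (ltn_ord a)) //.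
by congr l; apply/val_inj; rewrite /= modn_small.
Qed.

Lemma admissible_nat l : admissible l -> nat_admissible n (nat_spectrum l).
Proof.
case=> lN conv_gt0 sum_gt0 l_le _; split.
- by move=> m; rewrite nat_spectrum_conv.
- by rewrite nat_spectrum_sum.
move=> k; have l0E : nat_spectrum l 0 = l 0.
  by rewrite /nat_spectrum /=; congr l; apply/val_inj; rewrite /= mod0n.
rewrite l0E /nat_spectrum; case: ifP => // _; rewrite normr0.
exact: le_trans (l_le 0).
Qed.

(** A coset other than the subgroup of multiples of [d] carries only nonpositive values, so its sum
    is nonpositive. *)
Lemma multiples_absurd l d : admissible l -> (d %| n)%N -> (1 < d)%N ->
  (forall m : V, 0 < l m -> (d %| m)%N) -> False.
Proof.
move=> [_ conv_gt0 sum_gt0 _ _] dn d_gt1 supp.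
have n_gt1 : (1 < n)%N by apply: leq_trans d_gt1 (dvdn_leq _ dn).
apply: (@coset_sum_absurd _ _ [pred m : V | d %| m]%N _ _ l conv_gt0 sum_gt0).
- by rewrite inE dvdn0.
- move=> i j; rewrite !inE /= => di dj; rewrite modnDmr /dvdn modn_dvdm //.
  by rewrite -/(dvdn _ _) dvdn_add ?dvdn_sub // ltnW.
- by exists (inZp 1); rewrite inE /= modn_small // dvdn1 neq_ltn d_gt1 orbT.
move=> x; rewrite inE => dx; apply: sumr_le0 => j; rewrite inE => dj.
rewrite leNgt; apply: contra dx => /supp /=; rewrite /dvdn modn_dvdm //.
by rewrite -!/(dvdn _ _) dvdn_addl.
Qed.

End Admissible.

(** * Small symmetric sets of positive indices *)

Section FewPositive.

Variables (R : realType) (n' : nat).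
Local Notation n := n'.+1.
Local Notation V := 'I_n.

Section SymmetricSet.

Variable P : {set V}.
Hypothesis P0 : 0 \in P.
Hypothesis PN : forall m, m \in P -> - m \in P.

Let size_le_P (s : seq V) : uniq s -> {subset s <= P} -> (size s <= #|P|)%N.
Proof. by move=> s_uniq sP; rewrite cardE uniq_leq_size // => x /sP; rewrite mem_enum. Qed.

Let neq_sym (m : V) : - m != m -> (m == 0 = false) * (- m == 0 = false) * (m == - m = false).
Proof.
move=> mN; have m0 : m != 0 by apply: contraNneq mN => ->; rewrite oppr0.
by rewrite oppr_eq0 (negPf m0) eq_sym (negPf mN).
Qed.

(** Indices that differ from their opposites come in pairs, and 0 is always present. The next two
    lemmas count the same way. *)
Lemma card_lt3_self_opp m : (#|P| < 3)%N -> m \in P -> - m = m.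
Proof.
move=> P3 Pm; apply/eqP; apply: contraTT P3 => /neq_sym mE; rewrite -leqNgt.
apply: (@size_le_P [:: 0; m; - m]); first by rewrite /= !inE ![0 == _]eq_sym !mE.
by move=> x; rewrite !inE => /or3P[]/eqP->; rewrite ?PN.
Qed.

Lemma card_lt4_self_opp :
  (#|P| < 4)%N -> (forall m, m \in P -> - m = m) \/
  exists s, forall m, m \in P -> m \in [:: 0; s; - s].
Proof.
move=> P4; have [all_self|] := boolP [forall m in P, - m == m].
  by left=> m Pm; apply/eqP; move/forall_inP: all_self; apply.
rewrite negb_forall_in => /exists_inP[s Ps /neq_sym sE]; right; exists s => m Pm.
apply: contraTT P4; rewrite !inE => m_nin; rewrite -leqNgt.
apply: (@size_le_P [:: m; 0; s; - s]).
  by rewrite /= !inE ![0 == _]eq_sym !sE m_nin.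
by move=> x; rewrite !inE => /or4P[]/eqP->; rewrite ?PN.
Qed.

Lemma card_lt5_self_opp :
  (#|P| < 5)%N -> exists s, forall m, m \in P -> - m = m \/ m \in [:: s; - s].
Proof.
move=> P5; have [all_self|] := boolP [forall m in P, - m == m].
  by exists 0 => m Pm; left; apply/eqP; move/forall_inP: all_self; apply.
rewrite negb_forall_in => /exists_inP[s Ps /neq_sym sE]; exists s => m Pm.
have [/eqP|/neq_sym mE] := boolP (- m == m); [by left | right].
apply: contraTT P5; rewrite !inE negb_or => /andP[ms msN]; rewrite -leqNgt.
apply: (@size_le_P [:: 0; s; - s; m; - m]).
  rewrite /= !inE ![0 == _]eq_sym !sE !mE /= ![_ == - m]eq_sym eqr_opp.
  by rewrite eqr_oppLR ![_ == m]eq_sym (negPf ms) (negPf msN).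
move=> x; rewrite !inE => /orP[/eqP->//|/or4P[]/eqP->]; by rewrite ?PN.
Qed.

End SymmetricSet.

(** Its multiples in Z/n are the self-opposite indices: 0, and [n / 2] when [n] is even. *)
Definition half_order : nat := if odd n then n else n./2.

Lemma self_opp_dvdn (m : V) : - m = m -> (half_order %| m)%N.
Proof.
move/eqP; rewrite eq_sym -addr_eq0 => /eqP/(congr1 val) /= /eqP.
rewrite -/(dvdn n _) addnn -muln2 /half_order; case: ifP => [n_odd|n_even].
  by rewrite Gauss_dvdl // coprimen2.
by rewrite -{1}(odd_double_half n) n_even -muln2 dvdn_pmul2r.
Qed.

Lemma half_order_dvdn : (half_order %| n)%N.
Proof.
rewrite /half_order; case: ifP => // n_even.
by rewrite -{2}(odd_double_half n) n_even -muln2 dvdn_mulr.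
Qed.

(* Dilating the spectrum by a unit [u] amounts to replacing the primitive root of
   unity [w] by [w ^+ u], see [dft_expr]. *)
Definition unit_admissible (l : V -> R) : Prop :=
  forall u, coprime u n -> admissible (fun m => l (m *+ u)).

Variable l : V -> R.
Hypothesis l_scal : unit_admissible l.
Let P := [set m | 0 < l m].

Let l_adm : admissible l.
Proof. by have := l_scal (coprime1n n). Qed.

Lemma positive_set0 : 0 \in P.
Proof.
rewrite inE; case: l_adm => _ _ sum_gt0 l_le _.
rewrite ltNge; apply: contraL sum_gt0 => l0; rewrite -leNgt.
by apply: sumr_le0 => m _; rewrite (le_trans (ler_norm _)) // (le_trans (l_le m)).
Qed.

Lemma positive_setN m : m \in P -> - m \in P.
Proof. by rewrite !inE; case: l_adm => ->. Qed.

Lemma card_lt3_odd_absurd : odd n -> (1 < n)%N -> (#|P| < 3)%N -> False.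
Proof.
move=> n_odd n_gt1 P3; apply: (multiples_absurd l_adm (dvdnn n) n_gt1) => m l_m.
have Pm : m \in P by rewrite inE.
by have := self_opp_dvdn (card_lt3_self_opp positive_set0 positive_setN P3 Pm);
  rewrite /half_order n_odd.
Qed.

(** Otherwise [gcdn s t] would be a common divisor of [n] and of all positive indices, against
    [multiples_absurd]. *)
Lemma coprime_support (t : nat) (s : V) : (t %| n)%N -> (1 < t)%N ->
  (forall m, 0 < l m -> (t %| m)%N \/ m \in [:: s; - s]) -> coprime s t.
Proof.
move=> tn t_gt1 supp; rewrite /coprime eqn_leq gcdn_gt0 (ltnW t_gt1) orbT andbT.
rewrite leqNgt; apply/negP => g_gt1.
have g_dvd_n : (gcdn s t %| n)%N by rewrite (dvdn_trans (dvdn_gcdr _ _)).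
apply: (multiples_absurd l_adm g_dvd_n g_gt1) => m /supp[|].
  exact/dvdn_trans/dvdn_gcdr.
rewrite !inE => /orP[]/eqP->; first exact: dvdn_gcdl.
by rewrite /= /dvdn modn_dvdm // -/(dvdn _ _) dvdn_subr ?dvdn_gcdl // ltnW.
Qed.

End FewPositive.

(** * Moving the support by a unit *)

Section Dilation.

Variables (R : realType) (n' : nat).
Local Notation n := n'.+1.
Local Notation V := 'I_n.
Variable l : V -> R.
Hypothesis l_scal : unit_admissible l.

Lemma dilate_support (t u : nat) (v s : V) : (t %| n)%N ->
  coprime u n -> v *+ u = s ->
  (forall m, 0 < l m -> (t %| m)%N \/ m \in [:: s; - s]) ->
  forall m, 0 < l (m *+ u) -> (t %| m)%N \/ m \in [:: v; - v].
Proof.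
move=> tn co_un vs supp m /supp[|].
  rewrite Zp_mulrn /= /dvdn modn_dvdm // -/(dvdn _ _).
  by rewrite Gauss_dvdl; [left | rewrite coprime_sym (coprime_dvdr tn)].
by rewrite !inE -vs -mulNrn !(inj_eq (mulrn_coprime_inj co_un)); right.
Qed.

Lemma support_nat (t v : nat) : (0 < v < n)%N ->
  (forall m, 0 < l m -> (t %| m)%N \/ m \in [:: inZp v; - inZp v]) ->
  forall k, ~~ (t %| k)%N -> k != v -> (k + v != n)%N -> nat_spectrum l k <= 0.
Proof.
move=> /andP[v_gt0 v_lt] supp k tk kv kvn; rewrite /nat_spectrum; case: ifP => // k_le.
have k_lt : (k < n)%N by lia.
rewrite leNgt; apply/negP => /supp[|].
  by rewrite /= modn_small // (negPf tk).
by rewrite !inE => /orP[]/eqP/(congr1 val) /=; rewrite !modn_small //; lia.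
Qed.

(** Without a positive value at [v], all positive indices would be multiples of [t]. *)
Lemma nat_spectrum_gt0 (t v : nat) : (v <= n./2)%N -> admissible l ->
  (t %| n)%N -> (1 < t)%N ->
  (forall m, 0 < l m -> (t %| m)%N \/ m \in [:: inZp v; - inZp v]) ->
  0 < nat_spectrum l v.
Proof.
move=> v_le l_adm tn t_gt1 supp; rewrite /nat_spectrum v_le.
rewrite ltNge; apply/negP => lv.
apply: (multiples_absurd l_adm tn t_gt1) => m lm; have [//|] := supp m lm.
have [lN _ _ _ _] := l_adm.
by rewrite !inE => /orP[]/eqP mE; move: lm; rewrite mE ?lN ltNge lv.
Qed.

(** The coset argument for the subgroup of order two, whose cosets are the pairs [k],
    [k + n / 2]. *)
Lemma coset_pair_absurd : admissible l -> ~~ odd n ->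
  (forall k, (k < n)%N -> ~~ (n./2 %| k)%N ->
     nat_spectrum l (fold_index n k) +
     nat_spectrum l (fold_index n ((k + n./2) %% n)) <= 0) -> (2 < n)%N -> False.
Proof.
move=> [lN conv_gt0 sum_gt0 _ _] n_even pair_le0 n_gt2.
have nE : (n./2 + n./2 = n)%N by lia.
have [t val_t] : exists t : V, t = n./2 :> nat.
  by exists (inZp n./2); rewrite /= modn_small; lia.
have tt : t + t = 0 by apply/val_inj; rewrite [LHS]/= !val_t nE modnn.
have t0 : t != 0 by rewrite -val_eqE [val _]val_t; apply/eqP => /=; lia.
have tN : - t = t by apply/eqP; rewrite eq_sym -addr_eq0 tt.
apply: (@coset_sum_absurd _ _ (pred2 0 t) _ _ l conv_gt0 sum_gt0).
- by rewrite !inE eqxx.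
- move=> i j; rewrite !inE => /orP[]/eqP-> /orP[]/eqP->;
  by rewrite ?subr0 ?sub0r ?subrr ?tN ?eqxx ?orbT.
- exists (inZp 1); by rewrite !inE -!val_eqE [val t]val_t /= modn_small; lia.
move=> x; rewrite !inE negb_or => /andP[x0 xt].
rewrite /coset_sum (bigD1 0) ?inE ?eqxx //= (big_pred1 t); last first.
  move=> j; rewrite !inE; have [->|_] := eqVneq j 0; last by rewrite andbT.
  by rewrite eq_sym (negPf t0).
have := pair_le0 x (ltn_ord x).
rewrite !nat_spectrumE ?(ltnW (ltn_pmod _ _)) ?(ltnW (ltn_ord x)) //.
have -> : inZp x = x :> V by apply/val_inj; rewrite /= modn_small.
have -> : inZp ((x + n./2) %% n) = x + t :> V.
  by apply/val_inj; rewrite /= modn_mod val_t.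
rewrite addr0; apply; apply: contra x0 => /dvdnP[[|[|q]] xE].
- by rewrite -val_eqE /= xE.
- by move: xt; rewrite -val_eqE [val t]val_t /= xE mul1n eqxx.
- by have := ltn_ord x; rewrite xE; nia.
Qed.

Lemma generator_absurd : admissible l ->
  n \in [:: 6; 7; 8; 9; 11; 13; 15]%N ->
  (forall m, 0 < l m -> (n %| m)%N \/ m \in [:: inZp 1; - inZp 1]) -> False.
Proof.
move=> l_adm n_in supp.
have n_gt1 : (1 < n)%N by move: n_in; rewrite !inE; lia.
have n2_gt0 : (1 <= n./2)%N by rewrite half_gt0.
have F1 := nat_spectrum_gt0 n2_gt0 l_adm (dvdnn n) n_gt1 supp.
have Z k : (n./2 < k)%N -> nat_spectrum l k = 0.
  by rewrite /nat_spectrum ltnNge => /negPf->.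
have N k : (1 < k)%N -> nat_spectrum l k <= 0.
  move=> k_gt1; have [k_n|k_n] := ltnP n./2 k; first by rewrite Z.
  by apply: (support_nat _ supp) => //; rewrite ?gtnNdvd //; lia.
have F_adm := admissible_nat l_adm.
move: n_in; rewrite !inE => /or4P[/eqP n_eq|/eqP n_eq|/eqP n_eq|n_in].
- exact: (generator_absurd6 F_adm n_eq).
- exact: (generator_absurd7 F_adm n_eq).
- exact: (generator_absurd8 F_adm n_eq).
by apply: (generator_absurd_odd F_adm) => //; rewrite !inE.
Qed.

End Dilation.

(** * Lower bounds for each order *)

Section FewPositiveAbsurd.

Variables (R : realType) (n' : nat).
Local Notation n := n'.+1.
Local Notation V := 'I_n.
Variable l : V -> R.
Hypothesis l_scal : unit_admissible l.
Let P := [set m | 0 < l m].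

Let l_adm : admissible l.
Proof. by have := l_scal (coprime1n n). Qed.

Let inZp1_mulrn (s : V) : inZp 1 *+ s = s.
Proof. by apply/val_inj; rewrite Zp_mulrn /= modnMml mul1n modn_small. Qed.

Let half_orderE : half_order n' = if odd n then n else n./2.
Proof. by []. Qed.

Lemma generator_support_absurd (s : V) :
  n \in [:: 6; 7; 8; 9; 11; 13; 15]%N ->
  (forall m, 0 < l m -> (n %| m)%N \/ m \in [:: s; - s]) -> False.
Proof.
move=> n_in supp; have n_gt1 : (1 < n)%N by move: n_in; rewrite !inE; lia.
have co_s := coprime_support l_scal (dvdnn n) n_gt1 supp.
apply: (@generator_absurd _ _ (fun m => l (m *+ s))) => //; first exact: l_scal.
exact: dilate_support supp.
Qed.

Lemma card_lt4_absurd : n \in [:: 6; 8]%N -> (#|P| < 4)%N -> False.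
Proof.
move=> n_in P4.
have n_even : odd n = false by move: n_in; rewrite !inE => /orP[]/eqP->.
have [all_self|[s supp]] :=
    card_lt4_self_opp (positive_set0 l_scal) (positive_setN l_scal) P4.
  apply: (multiples_absurd l_adm (half_order_dvdn n')) => [|m lm].
    by rewrite half_orderE n_even; move: n_in; rewrite !inE => /orP[]/eqP->.
  by apply/self_opp_dvdn/all_self; rewrite inE.
apply: (@generator_support_absurd s); first by move: n_in; rewrite !inE; lia.
move=> m lm; have := supp m; rewrite !inE => /(_ lm)/orP[/eqP->|]; last by right.
by left; rewrite dvdn0.
Qed.

Lemma card_lt5_support : (#|P| < 5)%N ->
  exists s, forall m, 0 < l m -> (half_order n' %| m)%N \/ m \in [:: s; - s].
Proof.
move=> P5.
have [s supp] := card_lt5_self_opp (positive_set0 l_scal) (positive_setN l_scal) P5.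
exists s => m lm; have [||] := supp m; rewrite ?inE //; last by right.
by move/self_opp_dvdn; left.
Qed.

Lemma card_lt5_odd_absurd : n \in [:: 7; 9; 11; 13; 15]%N -> (#|P| < 5)%N -> False.
Proof.
move=> n_in /card_lt5_support[s].
have -> : half_order n' = n.
  by rewrite half_orderE ifT //; move: n_in; rewrite !inE; lia.
by apply: generator_support_absurd; move: n_in; rewrite !inE; lia.
Qed.

Lemma card_lt5_absurd12 : n = 12%N -> (#|P| < 5)%N -> False.
Proof.
move=> n12 /card_lt5_support[s].
have -> : half_order n' = 6 by rewrite half_orderE n12.
move=> supp.
have t_n : (6 %| n)%N by rewrite n12.
have co_s := coprime_support l_scal t_n isT supp.
(* 6 and 12 have the same prime factors, so [s] is a unit and can be moved to 1. *)
have co_sn : coprime s n.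
  move: (nat_of_ord s) co_s => u co_u.
  by rewrite n12 (coprimeMr _ 2 6) co_u (coprime_dvdr _ co_u).
have l'_adm := l_scal co_sn.
have supp' := dilate_support t_n co_sn (inZp1_mulrn s) supp.
have N k : (1 < k < 5)%N -> nat_spectrum (fun m => l (m *+ s)) k <= 0.
  move=> /andP[k_gt1 k_lt5]; apply: (support_nat _ supp'); rewrite ?gtnNdvd //; lia.
have F_adm := admissible_nat l'_adm.
have pair_absurd := coset_pair_absurd l'_adm.
move: (nat_spectrum _) N F_adm pair_absurd => F N F_adm.
have F15 : F 1%N + F 5%N <= 0.
  exact: (generator_absurd12 F_adm).
move: (N 2%N isT) (N 3%N isT) (N 4%N isT) F15 => {N F_adm}.
rewrite n12 => N2 N3 N4 F15; apply => // k.
(* The pairs [k], [k + 6] fold to 1 and 5, 2 and 4, or 3 twice. *)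
by do 12?[case: k => [|k]] => //= _ _; rewrite /fold_index !minnE /=; lra.
Qed.

Lemma card_lt5_absurd14 : n = 14%N -> (#|P| < 5)%N -> False.
Proof.
move=> n14 /card_lt5_support[s].
have -> : half_order n' = 7 by rewrite half_orderE n14.
move=> supp; have t_n : (7 %| n)%N by rewrite n14.
have co_s := coprime_support l_scal t_n isT supp.
(* An odd [s] is itself a unit. For even [s] the unit is [s + 7], and [8 * (s + 7)] equals [s]
   modulo 14; index 8 folds to 6. *)
have [u [v [co_un v_in vu]]] :
    exists u v, [/\ coprime u n, v \in [:: 1; 8]%N & inZp v *+ u = s :> V].
  have [s_odd|s_even] := boolP (odd s).
    exists s, 1%N; split=> //.
    move: (nat_of_ord s) co_s s_odd => u co_u u_odd.
    by rewrite n14 (coprimeMr _ 2 7) co_u coprimen2 u_odd.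
  exists (s + 7)%N, 8%N; split=> //.
    move: (nat_of_ord s) co_s s_even => u co_u u_even.
    rewrite n14 (coprimeMr _ 2 7) coprimen2 oddD (negPf u_even).
    by rewrite -coprime_modl modnDr coprime_modl.
  have -> : inZp 8 *+ (s + 7) = inZp (8 * (s + 7)) :> V.
    by apply/val_inj; rewrite Zp_mulrn /= modnMml.
  apply/val_inj => /=; rewrite -[RHS](modn_small (ltn_ord s)).
  by move: (nat_of_ord s) s_even => u; rewrite n14; lia.
have l'_adm := l_scal co_un.
have supp' := dilate_support t_n co_un vu supp.
have N k : (1 < k < 6)%N -> nat_spectrum (fun m => l (m *+ u)) k <= 0.
  move=> /andP[k_gt1 k_lt6]; apply: (support_nat _ supp'); rewrite ?gtnNdvd //;
  by move: v_in; rewrite !inE; lia.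
have F_adm := admissible_nat l'_adm.
have pair_absurd := coset_pair_absurd l'_adm.
have bound : 0 <= nat_spectrum (fun m => l (m *+ u)) 0 + nat_spectrum (fun m => l (m *+ u)) 7
    + nat_spectrum (fun m => l (m *+ u)) 2 + nat_spectrum (fun m => l (m *+ u)) 5.
  (* Modulo 14, [7 + 2] and [7 - 2] are opposite, so the product inequality has a single averaged
     term, the value at 5. *)
  have [l'N _ _ _ /(_ (inZp 7) (inZp 2))] := l'_adm.
  have -> : inZp 7 + inZp 2 = - inZp 5 :> V.
    by apply/val_inj => /=; rewrite n14.
  have -> : inZp 7 - inZp 2 = inZp 5 :> V.
    by apply/val_inj => /=; rewrite n14.
  have -> : 0 = inZp 0 :> V by apply/val_inj; rewrite /= mod0n.
  rewrite l'N /nat_spectrum n14 /=; lra.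
move: (nat_spectrum _) N F_adm pair_absurd bound => F N F_adm pair_absurd bound.
have := generator_absurd14 F_adm n14 N bound.
move: (N 2%N isT) (N 3%N isT) (N 4%N isT) (N 5%N isT) pair_absurd => {N F_adm}.
rewrite n14 => N2 N3 N4 N5 + F16; apply => // k.
by do 14?[case: k => [|k]] => //= _ _; rewrite /fold_index !minnE /=; lra.
Qed.

Lemma card_lt5_absurd10 : n = 10%N -> (#|P| < 5)%N -> False.
Proof.
move=> n10 /card_lt5_support[s].
have -> : half_order n' = 5 by rewrite half_orderE n10.
move=> supp; have t_n : (5 %| n)%N by rewrite n10.
have co_s := coprime_support l_scal t_n isT supp.
(* An even [s] is twice an odd [u] modulo 10, because adding 5 to [u] does not change [2 * u]; this
   [u] is a unit. *)
have [u [v [co_un v_in vu]]] :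
    exists u v, [/\ coprime u n, v \in [:: 1; 2]%N & inZp v *+ u = s :> V].
  have [s_odd|s_even] := boolP (odd s).
    exists s, 1%N; split=> //.
    move: (nat_of_ord s) co_s s_odd => u co_u u_odd.
    by rewrite n10 (coprimeMr _ 2 5) co_u coprimen2 u_odd.
  have [u u_odd s2u] : exists2 u, odd u & (s = 2 * u %[mod 10])%N.
    by case: (boolP (odd s./2)) => h; [exists s./2 | exists (s./2 + 5)%N] => //; lia.
  exists u, 2%N; split=> //.
    rewrite n10 (coprimeMr _ 2 5) coprimen2 u_odd.
    have : coprime (2 * u) 5.
      rewrite -coprime_modl -(modn_dvdm (2 * u) (isT : 5 %| 10)%N) -s2u.
      by rewrite modn_dvdm // coprime_modl.
    by rewrite coprimeMl => /andP[].
  have -> : inZp 2 *+ u = inZp (2 * u) :> V.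
    by apply/val_inj; rewrite Zp_mulrn /= modnMml.
  apply/val_inj; rewrite /= -[RHS](modn_small (ltn_ord s)).
  by move: (nat_of_ord s) s2u => x; rewrite n10.
have l'_adm := l_scal co_un.
have supp' := dilate_support t_n co_un vu supp.
have N := support_nat _ supp'.
have F_adm := admissible_nat l'_adm.
have F_gt0 := nat_spectrum_gt0 _ l'_adm t_n isT supp'.
move: v_in; rewrite !inE => /orP[]/eqP vE; rewrite vE in N F_gt0 supp'.
  apply: (generator_absurd10 F_adm n10) => [k k_gt1 k5|]; last first.
    by apply: F_gt0; rewrite n10.
  have [k_le|k_gt] := leqP k n./2; last by rewrite /nat_spectrum leqNgt k_gt.
  by apply: N; rewrite ?n10 //; move: k_le; rewrite n10 /=; lia.
apply: (even_generator_absurd10 F_adm n10); try by apply: N; rewrite ?n10.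
  by apply: F_gt0; rewrite n10.
(* With [F 5 <= 0] every positive index would be even, which [multiples_absurd] excludes. *)
rewrite ltNge; apply/negP => F5.
have two_n : (2 %| n)%N by rewrite n10.
apply: (multiples_absurd l'_adm two_n) => // m lm.
have [|] := supp' m lm; last first.
  by rewrite !inE => /orP[]/eqP-> /=; rewrite n10.
move=> /dvdnP[[|[|q]] mE]; first by rewrite mE.
  have mE' : m = inZp 5 by apply/val_inj; rewrite /= mE n10.
  have n5 : (5 <= n./2)%N by rewrite n10.
  by move: F5; rewrite /nat_spectrum n5 -mE' leNgt lm.
by have := ltn_ord m; rewrite mE n10; lia.
Qed.

End FewPositiveAbsurd.

(** * The values of kappa_2 *)

Lemma kappa2_set_lower (R : realType) n' k j :
  (forall l : 'I_n'.+1 -> R, unit_admissible l ->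
     (#|[set m | (0 < l m)%R]| < k)%N -> False) ->
  kappa2_set R n'.+1 j -> (k <= j)%N.
Proof.
move=> absurd [H [symH circH posH pdH <-]].
have [h hN HE] := circulant_circ symH circH.
have [w prim_w] := prim_root_exists R[i] (ltn0Sn n').
rewrite HE entrywise_square_circ in pdH; rewrite HE.
rewrite (n_plus_count (char_poly_circ prim_w hN)) leqNgt; apply/negP.
apply: absurd => u co_un.
have -> : (fun m => dft w h (m *+ u)) = dft (w ^+ u) h.
  by apply/funext => m; rewrite dft_expr.
apply: dft_admissible => // [|k']; first by rewrite prim_root_exp_coprime.
by have := posH 0 k'; rewrite HE mxE subr0.
Qed.

Lemma kappa2_setE (R : realType) n k :
  kappa2_set R n k -> (forall j, kappa2_set R n j -> (k <= j)%N) ->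
  kappa2 R n = k.
Proof.
move=> set_k k_lb; apply: xget_unique; first by split=> // j /k_lb.
move=> j [set_j j_lb]; apply/eqP; rewrite eqn_leq k_lb // andbT.
exact: j_lb.
Qed.

(** The matrix is [circ (dft w l)], with eigenvalues [n * l m]. The dominance of [l 0] makes its
    entries positive, as each is at least [l 0] minus the other absolute values. *)
Lemma kappa2_set_spectrum (R : realType) n' (l : 'I_n'.+1 -> R) :
  (forall m, l (- m) = l m) -> (forall m, 0 < conv l m) ->
  \sum_m `|l m| < 2 * l 0 ->
  kappa2_set R n'.+1 #|[set m | 0 < l m]|.
Proof.
move=> lN conv_gt0 dom; have [w prim_w] := prim_root_exists R[i] (ltn0Sn n').
have n_gt0 : 0 < n'.+1%:R :> R by rewrite ltr0n.
pose h := dft w l; have hN k : h (- k) = h k by apply: dftN.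
have dft_h m : dft w h m = n'.+1%:R * l m by rewrite dft_dft.
exists (circ h); split.
- by apply/matrixP => i j; rewrite !mxE -opprB hN.
- exists (fun k => h (inZp k)) => i j; rewrite mxE; congr h; apply/val_inj => /=.
  by rewrite modn_mod modnDmr addnBA // ltnW.
- move=> i j; rewrite mxE; move: (j - i) => k.
  rewrite /h /dft (bigD1 0) //= csm0 mulr1.
  have := ler_norm (- \sum_(m | m != 0) l m * cs w k m).
  have : `|- \sum_(m | m != 0) l m * cs w k m| <= \sum_(m | m != 0) `|l m|.
    rewrite normrN; apply: le_trans (ler_norm_sum _ _ _) _; apply: ler_sum => m _.
    by rewrite normrM ler_piMr ?cs_le1.
  move: dom; rewrite (bigD1 0) //=; have := ler_norm (l 0); lra.
- rewrite entrywise_square_circ; apply: (dft_positive_definite prim_w).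
    by move=> k; rewrite hN.
  move=> m; rewrite -(pmulr_rgt0 _ n_gt0) -conv_dft //.
  have -> : conv (dft w h) m = n'.+1%:R ^+ 2 * conv l m.
    rewrite /conv mulr_sumr; apply: eq_bigr => a _; rewrite !dft_h; ring.
  by rewrite mulr_gt0 ?exprn_gt0.
- rewrite (n_plus_count (char_poly_circ prim_w hN)).
  by apply: eq_card => m; rewrite !inE dft_h pmulr_rgt0.
Qed.

(** Integer folds over index lists, so that the upper bounds are decided by computation; [z] lists
    the values at [0, ..., n / 2]. *)
Definition int_conv (n : nat) (z : seq int) (m : nat) : int :=
  foldr (fun ij s => z`_ij.1 * z`_ij.2 + s) 0 (conv_index n m).

Definition dominant (n : nat) (z : seq int) : bool :=
  foldr (fun a s => `|z`_(fold_index n a)| + s) 0 (iota 0 n) < z`_0 + z`_0.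

Lemma kappa2_set_int (R : realType) n' (z : seq int) :
  all (fun m => 0 < int_conv n'.+1 z m) (iota 0 n'.+1) -> dominant n'.+1 z ->
  kappa2_set R n'.+1 (count (fun a => 0 < z`_(fold_index n'.+1 a)) (iota 0 n'.+1)).
Proof.
have foldr_sum (T : Type) (r : seq T) (F : T -> int) :
    foldr (fun i s => F i + s) 0 r = \sum_(i <- r) F i.
  by rewrite unlock.
have sum_iota (F : nat -> int) :
    \sum_(a <- iota 0 n'.+1) F a = \sum_(a < n'.+1) F a.
  by rewrite -[iota _ _]/(index_iota 0 n'.+1) big_mkord.
move=> /allP conv_gt0; rewrite /dominant foldr_sum sum_iota => dom.
pose l (m : 'I_n'.+1) : R := (z`_(fold_index n'.+1 m))%:~R.
have lN m : l (- m) = l m.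
  rewrite /l /= /fold_index; have [->|m0] := posnP m; first by rewrite subn0 modnn.
  by rewrite modn_small; [congr (nth _ _ _)%:~R|]; have := ltn_ord m; lia.
have -> : count (fun a => 0 < z`_(fold_index n'.+1 a)) (iota 0 n'.+1) =
    #|[set m | 0 < l m]|.
  rewrite -sum1_count -[iota _ _]/(index_iota 0 n'.+1) big_mkord -sum1dep_card.
  by apply: eq_bigl => m; rewrite /l ltr0z.
apply: kappa2_set_spectrum => // [m|].
  have -> : conv l m = (int_conv n'.+1 z m)%:~R.
    rewrite /int_conv foldr_sum big_map sum_iota rmorph_sum.
    by apply: eq_bigr => a _ /=; rewrite rmorphM /l /= modnDmr.
  by rewrite ltr0z conv_gt0 // mem_iota ltn_ord.
have -> : l 0 = (z`_0)%:~R by rewrite /l /fold_index min0n.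
have -> : \sum_m `|l m| = (\sum_(a < n'.+1) `|z`_(fold_index n'.+1 a)|)%:~R.
  by rewrite rmorph_sum; apply: eq_bigr => a _; rewrite /= intr_norm.
by rewrite mulr_natl mulr2n -rmorphD ltr_int.
Qed.

Theorem theorem5p2 (R : realType) :
  kappa2 R 5 = 3%N /\ kappa2 R 6 = 4%N /\ kappa2 R 7 = 5%N /\
  kappa2 R 8 = 4%N /\ kappa2 R 9 = 5%N /\ kappa2 R 10 = 5%N /\
  kappa2 R 11 = 5%N /\ kappa2 R 12 = 5%N /\ kappa2 R 13 = 5%N /\
  kappa2 R 14 = 5%N /\ kappa2 R 15 = 5%N.
Proof.
do ![split]; apply: kappa2_setE; try move=> j; try apply: kappa2_set_lower => l l_scal.
(* Up to [n = 13] the nonzero entries mark [S], and 5 exceeds the sum of the at most four ones off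
   index 0. *)
- by apply: (@kappa2_set_int R 4 [:: 5; 1; 0]); vm_compute.
- exact: (card_lt3_odd_absurd l_scal).
- by apply: (@kappa2_set_int R 5 [:: 5; 1; 0; 1]); vm_compute.
- exact: (card_lt4_absurd l_scal).
- by apply: (@kappa2_set_int R 6 [:: 5; 1; 1; 0]); vm_compute.
- exact: (card_lt5_odd_absurd l_scal).
- by apply: (@kappa2_set_int R 7 [:: 5; 1; 0; 0; 1]); vm_compute.
- exact: (card_lt4_absurd l_scal).
- by apply: (@kappa2_set_int R 8 [:: 5; 1; 1; 0; 0]); vm_compute.
- exact: (card_lt5_odd_absurd l_scal).
- by apply: (@kappa2_set_int R 9 [:: 5; 1; 0; 0; 1; 0]); vm_compute.
- exact: (card_lt5_absurd10 l_scal).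
- by apply: (@kappa2_set_int R 10 [:: 5; 0; 1; 1; 0; 0]); vm_compute.
- exact: (card_lt5_odd_absurd l_scal).
- by apply: (@kappa2_set_int R 11 [:: 5; 0; 1; 1; 0; 0; 0]); vm_compute.
- exact: (card_lt5_absurd12 l_scal).
- by apply: (@kappa2_set_int R 12 [:: 5; 0; 1; 1; 0; 0; 0]); vm_compute.
- exact: (card_lt5_odd_absurd l_scal).
(* Here [S] is 0, 1, 4 and opposites, and [S + S] misses 7, reached by the negative values at 2 and
   5. At index 2, [12 ^ 2] must outweigh [2 * 53] and the small cross terms, while dominance needs
   [53 > 2 * (12 + 1 + 12 + 1)]. *)
- by apply: (@kappa2_set_int R 13 [:: 53; 12; -1; 0; 12; -1; 0; 0]); vm_compute.
- exact: (card_lt5_absurd14 l_scal).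
(* With the same [S], the sums miss 6 and its opposite, reached as [3 + 3] by the negative value at
   3. *)
- by apply: (@kappa2_set_int R 14 [:: 45; 10; 0; -1; 10; 0; 0; 0]); vm_compute.
- exact: (card_lt5_odd_absurd l_scal).
Qed.
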